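(* Let $a<b<c$ be real numbers and let $$P=(x^-,y^-)\in(a,b)\times(0,1),\qquad Q=(x^+,y^+)\in(b,c)\times(0,1).$$ Then there exists at least one pair $(h,p)$, with $h\in H([0,1])$ and $p=(p^-,p^+)$ a pair of probability density functions, such that the graph of the membership function $f_{h,p}$ with parameters $a,b,c$ passes through $P$ and $Q$, i.e. $f_{h,p}(x^-)=y^-$ and $f_{h,p}(x^+)=y^+$.
   Context: A left auxiliary function (LAF) on $[0,1]$ is a function $h:(0,1)\to\mathbb{R}$ which is continuous and increasing on $(0,1)$ with $\lim_{x\to0^+}h(x)=-\infty$ and $\lim_{x\to1^-}h(x)=+\infty$. $H([0,1])$ denotes the set of all LAFs on $[0,1]$. A function $q:\mathbb{R}\to\mathbb{R}$ is a probability density function (PDF) if $q(t)\ge0$ for all $t\in\mathbb{R}$ and $\int_{-\infty}^{+\infty}q(y)\,dy=1$. Given $h\in H([0,1])$, a pair $p=(p^-,p^+)$ of PDFs and reals $a<b<c$, put $h^-(x)=h\left(\frac{x-a}{b-a}\right)$ for $x\in(a,b)$ and $h^+(x)=h\left(\frac{c-x}{c-b}\right)$ for $x\in(b,c)$. The membership function $f_{h,p}:\mathbb{R}\to[0,1]$ with parameters $a,b,c$ is defined by $f_{h,p}(x)=0$ for $x\in(-\infty,a]\cup[c,+\infty)$; $f_{h,p}(x)=\int_{-\infty}^{h^-(x)}p^-(y)\,dy$ for $x\in(a,b)$; $f_{h,p}(b)=1$; and $f_{h,p}(x)=\int_{-\infty}^{h^+(x)}p^+(y)\,dy$ for $x\in(b,c)$.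 *)

(* Defs.v *)
From HB Require Import structures.
From mathcomp Require Import all_boot all_order all_algebra.
From mathcomp Require Import all_classical all_reals all_analysis.

Set Implicit Arguments.
Unset Strict Implicit.
Unset Printing Implicit Defensive.

Import Order.TTheory GRing.Theory Num.Theory.
Import numFieldNormedType.Exports.

Local Open Scope classical_set_scope.
Local Open Scope ring_scope.

(* A left auxiliary function has domain the open interval ]0, 1[; it is encoded
   as a total function on R whose values outside ]0, 1[ are irrelevant: the
   membership function below only evaluates it inside ]0, 1[. "Increasing" is
   read strictly. *)
Definition is_LAF (R : realType) (h : R -> R) : Prop :=
  [/\ {within `]0, 1[, continuous h},
      {in `]0, 1[ &, {homo h : x y / x < y}},
      h x @[x --> 0^'+] --> -oo
    & h x @[x --> 1^'-] --> +oo].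

(* Measurability is implicit in writing the integral of q. The total mass is an
   extended real, so that the last condition includes integrability. *)
Definition is_pdf (R : realType) (q : R -> R) : Prop :=
  [/\ measurable_fun setT q,
      forall t : R, 0 <= q t
    & (\int[lebesgue_measure]_(y in setT) (q y)%:E = 1)%E].

Definition LAF_left (R : realType) (h : R -> R) (a b x : R) : R :=
  h ((x - a) / (b - a)).

Definition LAF_right (R : realType) (h : R -> R) (b c x : R) : R :=
  h ((c - x) / (c - b)).

Definition membership (R : realType) (h : R -> R)
    (p : (R -> R) * (R -> R)) (a b c x : R) : R :=
  if (x <= a) || (c <= x) then 0
  else if x < b then
    \int[lebesgue_measure]_(y in `]-oo, LAF_left h a b x]) p.1 y
  else if x == b then 1
  else \int[lebesgue_measure]_(y in `]-oo, LAF_right h b c x]) p.2 y.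

Lemma pdf_cdf_itv (R : realType) (q : R -> R) (u : R) : is_pdf q ->
  0 <= \int[lebesgue_measure]_(y in `]-oo, u]) q y <= 1.
Proof.
case=> mq q0 q1.
have h0 : (0 <= \int[lebesgue_measure]_(y in `]-oo, u]) (q y)%:E)%E.
  by apply: integral_ge0 => y _; rewrite lee_fin.
have h1 : (\int[lebesgue_measure]_(y in `]-oo, u]) (q y)%:E <= 1)%E.
  rewrite -q1; apply: ge0_subset_integral => //.
  - by apply/measurable_realfun.measurable_EFinP.
  - by move=> y _; rewrite lee_fin.
rewrite /Rintegral -!lee_fin fineK ?h0 ?h1//.
by rewrite ge0_fin_numE// (le_lt_trans h1) ?ltry.
Qed.

Lemma membership_itv (R : realType) (h : R -> R) (p : (R -> R) * (R -> R))
    (a b c x : R) : is_pdf p.1 -> is_pdf p.2 ->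
  0 <= membership h p a b c x <= 1.
Proof.
move=> p1 p2; rewrite /membership; case: ifP => _; first by rewrite lexx ler01.
case: ifP => _; first exact: pdf_cdf_itv.
by case: ifP => _; [rewrite ler01 lexx|exact: pdf_cdf_itv].
Qed.

(* Main.v *)
(** The logit [ln x - ln (1 - x)] serves as [h] for all data. A density that is
    constant equal to [y] on [ ]u - 1, u] ] and to [1 - y] on [ ]u, u + 1] ]
    puts mass exactly [y] below [u]; take [u] to be the value of [h^-] at [x^-],
    respectively of [h^+] at [x^+]. *)
Require Import Defs.
From mathcomp Require Import all_boot all_order all_algebra.
From mathcomp Require Import all_classical all_reals all_analysis.
From mathcomp Require Import measurable_realfun lra.
Import Order.TTheory GRing.Theory Num.Theory.
Import numFieldNormedType.Exports.
Local Open Scope classical_set_scope.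
Local Open Scope ring_scope.

Definition logit {R : realType} (x : R) : R := ln x - ln (1 - x).

(** This symmetry about [1 / 2] turns the limit at [0] into the limit at [1]. *)
Lemma logitN {R : realType} (x : R) : logit (1 - x) = - logit x.
Proof. by rewrite /logit subKr opprB. Qed.

Lemma logit_cvg0 {R : realType} : logit x @[x --> (0 : R)^'+] --> -oo.
Proof.
apply/cvgrNyPle => A.
(* For [x < 2^-1] the term [- ln (1 - x)] is at most [- ln 2^-1]; shifting the threshold by
   [ln 2^-1] absorbs it. *)
have /cvgrNyPle/(_ (A + ln 2^-1)) lnA := @lnNy R.
near=> x.
have x_lt : x < 2^-1 by near: x; apply: nbhs_right_lt; lra.
have lnx : ln x <= A + ln 2^-1 by near: x; exact: lnA.
rewrite /logit lerBlDr (le_trans lnx)// lerD2l ler_ln ?posrE; lra.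
Unshelve. all: by end_near. Qed.

Lemma logit_cvg1 {R : realType} : logit x @[x --> (1 : R)^'-] --> +oo.
Proof.
(* Writing the point as [1 - e] with [e] tending to [0] from the right reduces the claim to
   [logit e <= - A]. *)
apply/cvgryPge => A; apply/nbhs_left0P; near=> e.
rewrite logitN lerNr; near: e.
by have /cvgrNyPle/(_ (- A)) := @logit_cvg0 R.
Unshelve. all: by end_near. Qed.

Lemma logit_LAF {R : realType} : is_LAF (@logit R).
Proof.
split; [|move=> x y| exact: logit_cvg0 | exact: logit_cvg1].
- apply: continuous_in_subspaceT => x; rewrite inE/= in_itv/= => /andP[x0 x1].
  apply: cvgB; first exact: continuous_ln.
  apply: continuous_cvg; first by apply: continuous_ln; lra.
  by apply: cvgB; [exact: cvg_cst|exact: cvg_id].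
- rewrite !in_itv/= => /andP[x0 x1] /andP[y0 y1] xy.
  by rewrite /logit ltrD ?ltrN2 ?ltr_ln ?posrE//; lra.
Qed.

Definition two_step {R : realType} (u y t : R) : R :=
  y * \1_(`]u - 1, u]%classic : set R) t
  + (1 - y) * \1_(`]u, u + 1]%classic : set R) t.

Lemma measurable_two_step {R : realType} (u y : R) (D : set R) :
  measurable_fun D (two_step u y).
Proof.
by apply: measurable_funD; apply: measurable_funM => //; exact: measurable_indic.
Qed.

Lemma two_step_ge0 {R : realType} (u y t : R) : 0 <= y <= 1 ->
  0 <= two_step u y t.
Proof. by move=> /andP[y0 y1]; rewrite addr_ge0// mulr_ge0// subr_ge0. Qed.

(** The domain is left general to serve both the total mass ([D = setT]) and the distribution
    function at [u]. Since [y] and [1 - y] are nonnegative, additivity and homogeneity of the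
    integral need only measurability. *)
Lemma integral_two_step {R : realType} (u y : R) (D : set R) :
  measurable D -> 0 <= y <= 1 ->
  (\int[lebesgue_measure]_(t in D) (two_step u y t)%:E =
   y%:E * lebesgue_measure (`](u - 1)%R, u]%classic `&` D)
   + (1 - y)%:E * lebesgue_measure (`]u, (u + 1)%R]%classic `&` D))%E.
Proof.
move=> mD /andP[y0 y1]; have y1' : 0 <= 1 - y by rewrite subr_ge0.
under eq_integral do rewrite EFinD !EFinM.
have mI (I : interval R) :
    measurable_fun D (EFin \o (\1_[set` I] : R -> R)).
  by apply/measurable_EFinP; exact: measurable_indic.
rewrite ge0_integralD//; first last.
- by apply: measurable_funeM; exact: mI.
- by move=> x _; rewrite mule_ge0 ?lee_fin.
- by apply: measurable_funeM; exact: mI.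
- by move=> x _; rewrite mule_ge0 ?lee_fin.
by rewrite !ge0_integralZl ?integral_indic//; try exact: mI;
  move=> *; rewrite lee_fin.
Qed.

Lemma two_step_pdf {R : realType} (u y : R) : 0 <= y <= 1 ->
  is_pdf (two_step u y).
Proof.
move=> y01; split; first exact: measurable_two_step.
  by move=> t; exact: two_step_ge0.
(* Both steps have length [1], so the mass is [y + (1 - y)]. *)
rewrite integral_two_step// !setIT !lebesgue_measure_itv/= !lte_fin.
rewrite ltrBlDr ltrDl ltr01 -!EFinB -!EFinM -EFinD; congr EFin; lra.
Qed.

Lemma two_step_cdf {R : realType} (u y : R) : 0 <= y <= 1 ->
  \int[lebesgue_measure]_(t in `]-oo, u]) two_step u y t = y.
Proof.
move=> y01; rewrite /Rintegral integral_two_step//.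
(* With half-open steps, the ray up to [u] contains the first one entirely and is disjoint from the
   second. *)
rewrite (_ : _ `&` _ = `]u - 1, u]%classic); last first.
  by apply/setIidPl => x /=; rewrite !in_itv/= => /andP[].
rewrite (_ : `]u, u + 1]%classic `&` _ = set0); last first.
  by apply/seteqP; split=> x //=; rewrite !in_itv/=; lra.
rewrite measure0 mule0 adde0 lebesgue_measure_itv/= lte_fin ltrBlDr ltrDl ltr01.
by rewrite -EFinB -EFinM/= opprB addrC subrK mulr1.
Qed.

Theorem theorem3p1 (R : realType) (a b c : R) (xm ym xp yp : R)
    (hab : a < b) (hbc : b < c)
    (hxm : xm \in `]a, b[) (hym : ym \in `]0, 1[)
    (hxp : xp \in `]b, c[) (hyp : yp \in `]0, 1[) :
  exists (h : R -> R) (p : (R -> R) * (R -> R)),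
    [/\ is_LAF h, is_pdf p.1, is_pdf p.2,
        membership h p a b c xm = ym
      & membership h p a b c xp = yp].
Proof.
have ym01 : 0 <= ym <= 1 by move: hym; rewrite in_itv/=; lra.
have yp01 : 0 <= yp <= 1 by move: hyp; rewrite in_itv/=; lra.
move: hxm hxp; rewrite !in_itv/= => /andP[axm xmb] /andP[bxp xpc].
exists logit, (two_step (LAF_left logit a b xm) ym,
                    two_step (LAF_right logit b c xp) yp).
split; [exact: logit_LAF|exact: two_step_pdf|exact: two_step_pdf| |].
(* The strict bounds select the left branch, whose integral stops exactly at the jump point [u] of
   the chosen density. *)
- rewrite /membership leNgt axm/= leNgt (lt_trans xmb hbc)/= xmb.
  exact: two_step_cdf.
- rewrite /membership leNgt (lt_trans hab bxp)/= leNgt xpc/= ltNge (ltW bxp)/=.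
  by rewrite gt_eqF//; exact: two_step_cdf.
Qed.
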